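(* The category $\mathrm{ExtrDisc}$ does not admit all fibers; that is, there exist a morphism $f \colon X \to Y$ in $\mathrm{ExtrDisc}$ and a point $y \in Y$ such that the pullback of $f$ along $y \colon * \to Y$ does not exist in $\mathrm{ExtrDisc}$.
   Context: An extremally disconnected space is a compact Hausdorff space in which the closure of every open set is open. $\mathrm{ExtrDisc}$ is the category of extremally disconnected spaces and continuous maps; $*$ is the one-point space. *)

(* Defs.v *)
From mathcomp Require Import all_boot all_classical topology.

Set Implicit Arguments.
Unset Strict Implicit.
Unset Printing Implicit Defensive.

Local Open Scope classical_set_scope.

(* [compm g f] is "g after f". *)
Record category := Category {
  obj :> Type;
  hom : obj -> obj -> Type;
  idm : forall X, hom X X;
  compm : forall X Y Z, hom Y Z -> hom X Y -> hom X Z;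
  compm_idl : forall X Y (f : hom X Y), compm (idm Y) f = f;
  compm_idr : forall X Y (f : hom X Y), compm f (idm X) = f;
  compmA : forall X Y Z W (h : hom Z W) (g : hom Y Z) (f : hom X Y),
    compm h (compm g f) = compm (compm h g) f
}.

Definition is_pullback (C : category) (X Y Z : C) (f : hom X Y) (g : hom Z Y)
    (P : C) (p : hom P X) (q : hom P Z) : Prop :=
  compm f p = compm g q /\
  forall (W : C) (a : hom W X) (b : hom W Z), compm f a = compm g b ->
    exists! u : hom W P, compm p u = a /\ compm q u = b.

Definition has_pullback (C : category) (X Y Z : C) (f : hom X Y) (g : hom Z Y)
    : Prop :=
  exists (P : C) (p : hom P X) (q : hom P Z), is_pullback f g p q.

(* The empty space is allowed: [topologicalType] does not require a point. *)
Record extrDiscType := ExtrDiscType {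
  space :> topologicalType;
  extrDisc_compact : compact [set: space];
  extrDisc_hausdorff : hausdorff_space space;
  extrDisc_closure_open : forall U : set space, open U -> open (closure U)
}.

Definition cts_id (X : extrDiscType) : continuousType X X := idfun.

Definition cts_comp (X Y Z : extrDiscType) (g : continuousType Y Z)
  (f : continuousType X Y) : continuousType X Z := g \o f.

Lemma cts_comp_idl (X Y : extrDiscType) (f : continuousType X Y) :
  cts_comp (cts_id Y) f = f.
Proof. exact/continuousEP. Qed.

Lemma cts_comp_idr (X Y : extrDiscType) (f : continuousType X Y) :
  cts_comp f (cts_id X) = f.
Proof. exact/continuousEP. Qed.

Lemma cts_compA (X Y Z W : extrDiscType) (h : continuousType Z W)
    (g : continuousType Y Z) (f : continuousType X Y) :
  cts_comp h (cts_comp g f) = cts_comp (cts_comp h g) f.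
Proof. exact/continuousEP. Qed.

Definition ExtrDisc : category :=
  Category cts_comp_idl cts_comp_idr cts_compA.

Lemma discrete_unit_compact : compact [set: discrete_topology unit].
Proof. exact/finite_compact/finite_finset. Qed.

Lemma discrete_unit_hausdorff : hausdorff_space (discrete_topology unit).
Proof. exact: discrete_hausdorff. Qed.

Lemma discrete_unit_closure_open (U : set (discrete_topology unit)) :
  open U -> open (closure U).
Proof. by move=> _; exact: discrete_open. Qed.

Definition one_point : ExtrDisc :=
  ExtrDiscType discrete_unit_compact discrete_unit_hausdorff
    discrete_unit_closure_open.

Definition point_map (Y : ExtrDisc) (y : Y) : hom one_point Y :=
  (cst y : continuousType one_point Y).

(* Main.v *)
Require Import Defs.
From mathcomp Require Import all_boot all_classical topology.
From HB Require Import structures.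

(* The points of a pullback of f along y are the points of the fiber
   F = f^-1(y), and a continuous injection of compact Hausdorff spaces is an
   embedding, so a pullback would make F extremally disconnected.  Take the map
   beta(N x N) -> beta N induced by the first projection, and y = p a free
   ultrafilter.  The traces on F of the sets {(i, j) | j = n} have an open union
   V whose closure contains the limit r along p of the ultrafilters p x {n}.  No
   neighborhood of r in F lies in the closure of V: if B belongs to r, push p
   forward along i |-> (i, j i), where j i is the largest j <= i with (i, j) in
   B; this is a point of F containing B, and since j tends to infinity along p
   the graph of j is a neighborhood of it that avoids V. *)

Set Implicit Arguments.
Unset Strict Implicit.
Unset Printing Implicit Defensive.

Local Open Scope classical_set_scope.

(** * Ultrafilters and their topology *)

Lemma ultrafilterP (T : Type) (F : set_system T) :
  ProperFilter F -> (forall A, F A \/ F (~` A)) -> UltraFilter F.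
Proof.
move=> FF FC; split=> // G GF FG; apply/seteqP; split=> // A GA.
have [//|/FG GnA] := FC A.
by have /filter_ex [x []] : G (A `&` ~` A) by exact: filterI.
Qed.

Record ultrafilter (T : Type) := Ultrafilter {
  ultrafilter_sets :> set T -> Prop;
  ultrafilter_ultra :> UltraFilter ultrafilter_sets }.

#[global] Existing Instance ultrafilter_ultra.

HB.instance Definition _ (T : Type) := gen_eqMixin (ultrafilter T).
HB.instance Definition _ (T : Type) := gen_choiceMixin (ultrafilter T).

Section Ultrafilters.
Variable T : Type.
Implicit Types (p q : ultrafilter T) (A B : set T).

Lemma ultrafilter_eq p q : p `<=` q -> p = q.
Proof.
move=> pq; have e : q = p :> (set T -> Prop) by exact: max_filter pq.
case: p q e {pq} => [p pU] [q qU] /= e; rewrite e in qU *.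
by congr Ultrafilter; exact: Prop_irrelevance.
Qed.

Lemma ultrafilterC p A : p (~` A) <-> ~ p A.
Proof.
split=> [pnA pA|npA]; last by have [] := in_ultra_setVsetC A p.
by have /filter_ex [x []] : p (A `&` ~` A) by exact: filterI.
Qed.

Lemma ultrafilterI p A B : p (A `&` B) <-> p A /\ p B.
Proof.
split=> [pAB|[]]; last exact: filterI.
by split; apply: filterS pAB => x [].
Qed.

Definition principal (t : T) := Ultrafilter (principal_filter_ultra t).

Lemma principalE t A : principal t A <-> A t.
Proof. exact: principal_filterP. Qed.

Definition basic A : set (ultrafilter T) := [set p | p A].

Lemma basic_cover : \bigcup_(A in [set: set T]) basic A = setT.
Proof. by apply/seteqP; split=> // p _; exists setT => //; exact: filterT. Qed.

Lemma basic_join A B p : [set: set T] A -> [set: set T] B ->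
  basic A p -> basic B p ->
  exists C, [/\ [set: set T] C, basic C p & basic C `<=` basic A `&` basic B].
Proof.
move=> _ _ pA pB; exists (A `&` B).
by split=> // [|q /ultrafilterI//]; exact/ultrafilterI.
Qed.

End Ultrafilters.

HB.instance Definition _ (T : Type) :=
  isBaseTopological.Build (ultrafilter T) (@basic_cover T) (@basic_join T).

Lemma ultrafilter_map_subproof (S T : Type) (h : S -> T) (p : ultrafilter S) :
  UltraFilter (fun A : set T => p (h @^-1` A)).
Proof.
by apply: ultrafilterP => A; exact: in_ultra_setVsetC.
Qed.

Definition ultrafilter_map (S T : Type) (h : S -> T) (p : ultrafilter S) :=
  Ultrafilter (ultrafilter_map_subproof h p).

Lemma ultrafilter_lim_subproof (S T : Type) (v : S -> ultrafilter T)
  (F : set_system S) : UltraFilter F ->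
  UltraFilter (fun A : set T => F [set s | v s A]).
Proof.
move=> FU; apply: ultrafilterP => [|A]; last first.
  have [FA|FA] := in_ultra_setVsetC [set s | v s A] FU; first by left.
  by right; apply: filterS FA => s /ultrafilterC.
split=> [F0|].
  have /filter_ex [s] := F0; exact: filter_not_empty.
split=> [|A B FA FB|A B AB]; first by apply: filterS filterT => s _; exact: filterT.
- by apply: filterS (filterI FA FB) => s [? ?]; exact: filterI.
- by apply: filterS => s; exact: filterS.
Qed.

(** The limit of the points [v s] along [F] in the space of ultrafilters. With [v = id] it is the
    point to which an ultrafilter on that space converges. *)
Definition ultrafilter_lim (S T : Type) (v : S -> ultrafilter T)
    (F : set_system S) (FU : UltraFilter F) :=
  Ultrafilter (ultrafilter_lim_subproof v FU).

(** * Stone-Cech compactifications of discrete spaces *)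

Section UltrafilterSpace.
Variable T : Type.
Implicit Types (p : ultrafilter T) (A : set T) (U : set (ultrafilter T)).

Lemma open_basic A : open (basic A).
Proof. by exists [set A] => //; rewrite bigcup_set1. Qed.

Lemma nbhs_basic p A : p A -> nbhs p (basic A).
Proof. by move=> pA; apply: open_nbhs_nbhs; split=> //; exact: open_basic. Qed.

Lemma open_basicP U p : open U -> U p -> exists2 A, p A & basic A `<=` U.
Proof.
move=> [D _ <-] [A DA pA]; exists A => // q qA; by exists A.
Qed.

Lemma nbhs_basicP U p : nbhs p U -> exists2 A, p A & basic A `<=` U.
Proof.
rewrite nbhsE => -[V [oV Vp] VU].
have [A pA AV] := open_basicP oV Vp; exists A => //; exact: subset_trans VU.
Qed.

Lemma ultrafilter_compact : compact [set: ultrafilter T].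
Proof.
rewrite compact_ultra => F FU _.
exists (ultrafilter_lim id FU); split=> // U /nbhs_basicP[A FA AU].
exact: (filterS AU FA).
Qed.

Lemma ultrafilter_hausdorff : hausdorff_space (ultrafilter T).
Proof.
move=> p q pq; apply: ultrafilter_eq => A pA; apply: contrapT => /ultrafilterC qA.
have [r [rA /ultrafilterC//]] := pq _ _ (nbhs_basic pA) (nbhs_basic qA).
Qed.

Lemma open_principal U : open U -> U !=set0 -> exists t, U (principal t).
Proof.
move=> oU [p Up]; have [A pA AU] := open_basicP oU Up.
have [t At] := filter_ex pA; by exists t; apply: AU; exact/principalE.
Qed.

(** Principal ultrafilters are dense, so [closure U] is determined by the trace of [U] on them, and
    it is the basic open set of that trace. *)
Lemma ultrafilter_closure_open U : open U -> open (closure U).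
Proof.
move=> oU; suff -> : closure U = basic [set t | U (principal t)].
  exact: open_basic.
apply/seteqP; split=> p.
  move=> clUp; apply: contrapT => /ultrafilterC pnU.
  have := clUp _ (nbhs_basic pnU).
  case/(open_principal (openI oU (open_basic _))) => t [Ut].
  by move/principalE; exact.
move=> pU V /nbhs_basicP[B pB BV].
have [t [Bt Ut]] := filter_ex (filterI pB pU).
by exists (principal t); split=> //; apply: BV; exact/principalE.
Qed.

Definition stone_cech : ExtrDisc :=
  ExtrDiscType ultrafilter_compact ultrafilter_hausdorff
    ultrafilter_closure_open.

End UltrafilterSpace.

Lemma ultrafilter_map_continuous (S T : Type) (h : S -> T) :
  continuous (ultrafilter_map h).
Proof.
move=> p U /nbhs_basicP[A pA AU].
by apply: filterS (nbhs_basic (A := h @^-1` A) pA) => q qA; exact: AU.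
Qed.

Definition stone_cech_map (S T : Type) (h : S -> T) :
    hom (stone_cech S) (stone_cech T) :=
  (mkcts (@ultrafilter_map_continuous S T h)
    : continuousType (stone_cech S) (stone_cech T)).

(** By compactness [h] is a closed map; by injectivity [h x] avoids the image of the complement of
    [U]. *)
Lemma compact_injective_nbhs (X Y : topologicalType) (h : X -> Y) (x : X)
    (U : set X) : compact [set: X] -> hausdorff_space Y -> continuous h ->
  injective h -> open U -> U x -> exists2 V, nbhs (h x) V & h @^-1` V `<=` U.
Proof.
move=> cX hY ch hI oU Ux; exists (~` (h @` ~` U)); last first.
  by move=> z nz; apply: contrapT => nUz; apply: nz; exists z.
apply: open_nbhs_nbhs; split; last by move=> [z nUz /hI zx]; apply: nUz; rewrite zx.
apply: closed_openC; apply: compact_closed => //.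
apply: continuous_compact; first exact: continuous_subspaceT.
by apply: subclosed_compact cX _ => //; exact: open_closedC.
Qed.

(** * Pullbacks along a point *)

Section Pullback.
Variables (X Y P : ExtrDisc) (f : hom X Y) (y : Y).
Variables (g : hom P X) (q : hom P one_point).
Hypothesis pb : is_pullback f (point_map y) g q.

Lemma pullback_point_fiber (z : P) : f (g z) = y.
Proof. by have [/continuousEP /(_ z)] := pb. Qed.

Let point_comm (x : X) : f x = y ->
  compm f (point_map x) = compm (point_map y) (idm one_point).
Proof. by move=> fx; apply/continuousEP => t. Qed.

(** The universal property, tested on [one_point], lifts the point [x] to [P]. *)
Lemma pullback_point_surjective (x : X) : f x = y -> exists z : P, g z = x.
Proof.
move=> /point_comm /(proj2 pb) [u [[/continuousEP gu _] _]].
by exists (u tt); exact: gu tt.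
Qed.

(** Both [z] and [w] lift the same point of [X], and lifts from [one_point] are unique. *)
Lemma pullback_point_injective : injective g.
Proof.
move=> z w gzw.
have /(proj2 pb) [u [_ uU]] := point_comm (pullback_point_fiber z).
have lift t : g t = g z -> u = point_map t.
  move=> gt; apply: uU; split; apply/continuousEP => s; first exact: gt.
  have unit_eq (a b : unit) : a = b by case: a b => -[].
  exact: unit_eq.
have := lift z erefl; rewrite (lift w (esym gzw)).
by move/continuousEP => /(_ tt).
Qed.

Lemma pullback_point_nbhs (z : P) (U : set P) : open U -> U z ->
  exists2 V : set X, nbhs (g z) V & g @^-1` V `<=` U.
Proof.
apply: compact_injective_nbhs.
- exact: extrDisc_compact.
- exact: extrDisc_hausdorff.
- exact: cts_fun.
- exact: pullback_point_injective.
Qed.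

End Pullback.

(** * The fiber over a free ultrafilter *)

Definition slice_max (B : set (nat * nat)) (i : nat) : nat :=
  \max_(n < i.+1 | `[< B (i, val n) >]) n.

(** [n] is one of the finitely many candidates, so the maximum is attained; without a candidate it
    would be the default 0. *)
Lemma slice_maxP (B : set (nat * nat)) (i n : nat) : n <= i -> B (i, n) ->
  n <= slice_max B i /\ B (i, slice_max B i).
Proof.
rewrite -ltnS => ni Bin; split.
  by apply: (leq_bigmax_cond (Ordinal ni)); exact/asboolP.
have [|m /asboolP Bm mE] := @eq_bigmax_cond _
  (fun n : 'I_i.+1 => `[< B (i, val n) >]) val.
  by apply/card_gt0P; exists (Ordinal ni); exact/asboolP.
by rewrite /slice_max mE.
Qed.

Section FreeUltrafilter.
Variable p : ultrafilter nat.
Hypothesis p_free : forall n, p [set i | n <= i].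

Definition column (n : nat) : set (nat * nat) := [set t | t.2 = n].

(** Otherwise [p]-almost every index would equal [n], against freeness. *)
Lemma not_column_lim :
  let r := ultrafilter_lim (fun n => ultrafilter_map (fun i => (i, n)) p) p in
  forall n, ~ r (column n).
Proof.
move=> r n rn.
have [m [/= nm /filter_ex [i /= mn]]] := filter_ex (filterI (p_free n.+1) rn).
by move: nm; rewrite -mn ltnn.
Qed.

(** As [p] is free, some slice of [B] at height [m > n] is [p]-large, and [slice_max B i >= m] for
    all [i >= m] in that slice. *)
Lemma graph_slice_max (B : set (nat * nat)) :
  p [set n | p [set i | B (i, n)]] ->
  p [set i | B (i, slice_max B i)] /\ forall n, p [set i | n < slice_max B i].
Proof.
move=> rB; suff H n : p [set i | n < slice_max B i /\ B (i, slice_max B i)].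
  split=> [|n]; first by apply: filterS (H 0) => i [].
  by apply: filterS (H n) => i [].
have [m [pm nm]] := filter_ex (filterI rB (p_free n.+1)).
apply: filterS (filterI pm (p_free m)) => i [Bim mi].
by have [? ?] := slice_maxP mi Bim; split=> //; exact: leq_trans nm _.
Qed.

Lemma fiber_no_pullback :
  ~ has_pullback (stone_cech_map (@fst nat nat)) (point_map (p : stone_cech nat)).
Proof.
move=> [P [g [q pb]]].
(* The graph of [h] is a section of the first projection, so the pushforward of [p] lies over
   [p]. *)
have lift (h : nat -> nat) :
    exists z : P, g z = ultrafilter_map (fun i => (i, h i)) p.
  by apply: (pullback_point_surjective pb); apply/esym/ultrafilter_eq.
pose r := ultrafilter_lim (fun n => ultrafilter_map (fun i => (i, n)) p) p.
have [z gz] : exists z : P, g z = r.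
  apply: (pullback_point_surjective pb); apply/esym/ultrafilter_eq => A pA.
  by apply: (@filterS _ p _ setT) filterT => n _; exact: pA.
pose V := g @^-1` \bigcup_n basic (column n).
have oV : open V.
  apply: open_comp => [x _|]; first exact: cts_fun.
  by apply: bigcup_open => n _; exact: open_basic.
have clVz : closure V z.
  move=> W; rewrite nbhsE => -[U [oU Uz] UW].
  have [U' + U'U] := pullback_point_nbhs pb oU Uz.
  rewrite gz => /nbhs_basicP[A rA AU'].
  have [n /= pA] := @filter_ex _ p _ _ rA.
  have [w gw] := lift (fun=> n).
  exists w; split; last by apply/UW/U'U/AU'; rewrite gw.
  by exists n => //; rewrite gw; by apply: (@filterS _ p _ setT) filterT => i _.
(* Extremal disconnectedness of [P] makes [closure V] an open neighborhood of [z], so it contains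
   the trace of some [basic B] around [r]. *)
have [U + UV] := pullback_point_nbhs pb (extrDisc_closure_open oV) clVz.
rewrite gz => /nbhs_basicP[B rB BU].
have [pB jinf] := graph_slice_max rB.
have [w gw] := lift (slice_max B).
have clVw : closure V w by apply/UV/BU; rewrite gw.
pose C := [set t : nat * nat | t.2 = slice_max B t.1].
have : nbhs w (g @^-1` basic C).
  apply: cts_fun; apply: nbhs_basic; rewrite gw.
  by apply: (@filterS _ p _ setT) filterT => i _.
move=> /clVw [t [[n _ tn] tC]].
(* [g t] lies over [p], so its first coordinate almost surely satisfies [n < slice_max B i], whereas
   on column [n] the graph [C] forces equality. *)
have : ultrafilter_map fst (g t) [set i | n < slice_max B i].
  by rewrite [ultrafilter_map _ _](pullback_point_fiber pb).
have tnC : (g t : ultrafilter (nat * nat)) (column n `&` C).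
  by apply/ultrafilterI.
move=> /(filterI tnC) /filter_ex [[i j] [[/= jn jB]]].
by rewrite -jB jn ltnn.
Qed.

End FreeUltrafilter.

Theorem theorem4 :
  exists (X Y : ExtrDisc) (f : hom X Y) (y : Y),
    ~ has_pullback f (point_map y).
Proof.
(* An ultrafilter refining the filter of tails is free. *)
have [p [pU p_free]] := ultraFilterLemma eventually_filter.
exists (stone_cech (nat * nat)), (stone_cech nat), (stone_cech_map fst).
exists (Ultrafilter pU); apply: fiber_no_pullback => n.
by apply: p_free; exists n.
Qed.
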